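(* Assume that there is a Countryman line $(C,<)$ which is minimal for uncountable linear orders, i.e. $C$ embeds into every uncountable suborder of $C$. Then there is a Hagendorf order of size $\aleph_1$.
   Context: Work in ZFC. A Countryman line is an uncountable linear order $C$ such that $C\times C$, partially ordered componentwise, is the union of countably many chains. For linear orders or order types, $\varphi\le\psi$ means $\varphi$ embeds into $\psi$ by a strictly order-preserving map, and $\varphi<\psi$ means $\varphi\le\psi$ and $\psi\not\le\varphi$. The sum $\varphi+\psi$ places a copy of $\psi$ after a copy of $\varphi$. A type $\tau$ is strictly indecomposable to the right if whenever $\tau=\varphi+\psi$ with $\psi>0$ (i.e. $\psi$ non-empty), then $\varphi<\tau$ and $\tau\le\psi$. An order type $\varphi$ is Hagendorf if (1) $\varphi$ is strictly indecomposable to the right, (2) for every order type $\psi$, $\psi<\varphi$ implies $\psi+1\le\varphi$, and (3) $\varphi$ is not the type of an ordinal. A linear order is a Hagendorf order if its type is Hagendorf. *)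

(* Defs.v *)
From HB Require Import structures.
From mathcomp Require Import all_boot all_order.
From mathcomp Require Import all_classical.
From mathcomp Require wochoice.

Set Implicit Arguments.
Unset Strict Implicit.
Unset Printing Implicit Defensive.

Import Order.Theory.
Local Open Scope classical_set_scope.
Local Open Scope order_scope.

(* Order types are represented by linear orders [T : orderType d]; every notion
   below is invariant under isomorphism. *)

Definition embeds d1 d2 (A : orderType d1) (B : orderType d2) : Prop :=
  exists f : A -> B, {homo f : x y / x < y}.

Definition strictly_embeds d1 d2 (A : orderType d1) (B : orderType d2) : Prop :=
  embeds A B /\ ~ embeds B A.

Definition order_iso d1 d2 (A : orderType d1) (B : orderType d2) : Prop :=
  exists2 f : A -> B, bijective f & {mono f : x y / x < y}.

(* An alias of [A + B], so that the order below is not attached to every sum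
   type. *)
Definition osum (A B : Type) : Type := (A + B)%type.

Fact osum_display : Order.disp_t -> Order.disp_t -> Order.disp_t.
Proof. by move=> _ _; exact: (Order.Disp tt tt). Qed.

Section OrderedSum.
Context d1 d2 (A : orderType d1) (B : orderType d2).
Implicit Types x y z : osum A B.

Definition osum_le x y : bool :=
  match x, y with
  | inl a, inl a' => a <= a'
  | inl _, inr _ => true
  | inr _, inl _ => false
  | inr b, inr b' => b <= b'
  end.

Definition osum_lt x y : bool :=
  match x, y with
  | inl a, inl a' => a < a'
  | inl _, inr _ => true
  | inr _, inl _ => false
  | inr b, inr b' => b < b'
  end.

HB.instance Definition _ := Choice.on (osum A B).

Fact osum_lt_def x y : osum_lt x y = (y != x) && osum_le x y.
Proof. by case: x y => [a|b] [a'|b']; rewrite //= lt_def. Qed.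

Fact osum_le_anti : antisymmetric osum_le.
Proof. by case=> [a|b] [a'|b'] //= /le_anti ->. Qed.

Fact osum_le_trans : transitive osum_le.
Proof. by case=> [a|b] [a'|b'] [a''|b''] //=; exact: le_trans. Qed.

Fact osum_le_total : total osum_le.
Proof. by case=> [a|b] [a'|b'] //=; exact: le_total. Qed.

HB.instance Definition _ :=
  Order.isOrder.Build (osum_display d1 d2) (osum A B)
    osum_lt_def (fun _ _ => erefl) (fun _ _ => erefl)
    osum_le_anti osum_le_trans osum_le_total.

End OrderedSum.

Definition strictly_indecomposable_right d (T : orderType d) : Prop :=
  forall (d1 d2 : Order.disp_t) (A : orderType d1) (B : orderType d2),
    order_iso T (osum A B) -> inhabited B ->
    strictly_embeds A T /\ embeds T B.

Definition is_ordinal d (T : orderType d) : Prop :=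
  wochoice.well_order (fun x y : T => x <= y).

Definition hagendorf d (T : orderType d) : Prop :=
  [/\ strictly_indecomposable_right T,
      forall (d' : Order.disp_t) (P : orderType d'),
        strictly_embeds P T -> embeds (osum P 'I_1) T
    & ~ is_ordinal T].

Definition uncountable (T : Type) : Prop := ~ countable [set: T].

(* [*p] carries the componentwise order. *)
Definition countryman d (C : orderType d) : Prop :=
  uncountable C /\
  exists K : nat -> set (C *p C),
    (forall n, total_on (K n) (fun p q => p <= q)) /\
    \bigcup_n K n = [set: C *p C].

Definition minimal_uncountable d (C : orderType d) : Prop :=
  forall S : set C, ~ countable S ->
    exists2 f : C -> C, {homo f : x y / x < y} & forall x, S (f x).

(* The least uncountable ordinal: each proper initial segment of a well-order is
   of the form [{y | y < x}]. *)
Definition is_omega1 d (W : orderType d) : Prop :=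
  [/\ is_ordinal W, uncountable W & forall x : W, countable [set y | y < x]].

Definition has_card_aleph1 (T : Type) : Prop :=
  exists (d : Order.disp_t) (W : orderType d),
    is_omega1 W /\ ([set: T] #= [set: W])%card.

(* Main.v *)
Require Import Defs.
From HB Require Import structures.
From mathcomp Require Import all_boot all_order.
From mathcomp Require Import all_classical.
From mathcomp Require wochoice.

(** The Hagendorf order is built from a minimal Countryman line C and its
reverse D by alternating lexicographic products.

Two facts about C carry everything. First, C absorbs its own square: among
countably many chains covering C * C, one meets uncountably many rows in
uncountable sets, and these sets follow each other in C because they lie on
one chain, so minimality finds C copies of C in a row inside C
([countryman_lex_square]). Second, C and D do not embed into each other, since
a decreasing map C -> C has a graph that meets each chain in at most one point
([countryman_no_decreasing]).

Let E_0 = F_0 be a point, E_(n+1) the sum of C copies of F_n, and F_(n+1) the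
sum of D copies of E_n. Both sequences increase, each E_n embeds into F_(n+1)
and conversely, and E_n, F_n are incomparable for n > 0. The crucial point is
the dichotomy [tower_dichotomy]: a suborder of some E_n or F_n that contains no
copy of E_m embeds into F_m. The order wanted is the sum H of all E_n, n < omega
([sum_hagendorf]).

A proper initial segment of H lies in finitely many levels, so it embeds into a
single E_k with k > 0 and cannot contain E_(k+1); a final segment contains all
late levels, hence a copy of H. Let P be a suborder of H. Either its traces on
the levels contain, arbitrarily far up, copies of every E_m, and then H embeds
into P; or, from some level on, no trace contains E_m for some fixed m. In the
second case all traces embed into one E_M, a countable sum of suborders of E_M
still embeds into E_M, and there is room above level M for one more point. *)

Set Implicit Arguments.
Unset Strict Implicit.
Unset Printing Implicit Defensive.

Import Order.Theory.
Local Open Scope classical_set_scope.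
Local Open Scope order_scope.

(** * Countable sets, lexicographic products, embeddings *)

Lemma countable_inj_on (T U : Type) (A : set T) (B : set U) (f : T -> U) :
  (forall x, A x -> B (f x)) ->
  (forall x y, A x -> A y -> f x = f y -> x = y) -> countable B -> countable A.
Proof.
move=> fAB finj /countable_injP[g ginj]; apply/countable_injP.
exists (g \o f) => x y; rewrite !inE => Ax Ay /ginj e.
by apply: finj => //; apply: e; rewrite inE; exact: fAB.
Qed.

Lemma uncountable_pigeonhole (T : Type) (A : set T) (P : T -> nat -> Prop) :
  ~ countable A -> (forall x, A x -> exists n, P x n) ->
  exists n, ~ countable [set x | A x /\ P x n].
Proof.
move=> nA AP; apply: contrapT => /forallNP cP; apply: nA.
have -> : A = \bigcup_n [set x | A x /\ P x n].
  apply/seteqP; split=> [x Ax|x [n _ [Ax _]] //].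
  by have [n Pn] := AP x Ax; exists n.
by apply: bigcup_countable => // n _; apply: contrapT; exact: cP.
Qed.

Lemma ltlexP d d1 d2 (A : orderType d1) (B : orderType d2)
    (x y : A *lexi[d] B) :
  x < y <-> x.1 < y.1 \/ x.1 = y.1 /\ x.2 < y.2.
Proof.
rewrite Order.ProdLexiOrder.ltEprodlexi; split.
  case/andP; rewrite le_eqVlt => /orP[/eqP e|lt] h; [right|by left].
  by split=> //; move: h; rewrite e lexx.
case=> [lt|[-> lt]]; first by rewrite ltW //= leNgt lt.
by rewrite lexx.
Qed.

Lemma embeds_trans d1 d2 d3 (A : orderType d1) (B : orderType d2)
  (C : orderType d3) : embeds A B -> embeds B C -> embeds A C.
Proof. by move=> [f fP] [g gP]; exists (g \o f) => x y /fP/gP. Qed.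

Lemma homo_inj d1 d2 (A : orderType d1) (B : orderType d2) (f : A -> B) :
  {homo f : x y / x < y} -> injective f.
Proof.
move=> fP x y fxy; case: (ltgtP x y) => // /fP; by rewrite fxy ltxx.
Qed.

Lemma homo_ltV d1 d2 (A : orderType d1) (B : orderType d2) (f : A -> B) x y :
  {homo f : x y / x < y} -> f x < f y -> x < y.
Proof.
move=> fP; case: (ltgtP x y) => [//|/fP h h'|->]; last by rewrite ltxx.
by have := lt_trans h h'; rewrite ltxx.
Qed.

(** * Minimal Countryman lines *)

(** All that the construction uses about a single line. The condition is
invariant under order reversal, so that C and its reverse can exchange their
roles in every induction. *)
Definition idempotent_minimal d (L : orderType d) : Prop :=
  [/\ uncountable L, minimal_uncountable L & embeds (L *lexi[d] L) L].

Section Countryman.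
Variables (d : Order.disp_t) (C : orderType d).

(** For c < c' in two rows of a chain of the componentwise order, every point of
the first row lies weakly below every point of the second. Hence uncountable
rows of a single chain are C-many consecutive uncountable sets, each of which
contains a copy of C. *)
Lemma countryman_lex_square :
  countryman C -> minimal_uncountable C -> embeds (C *lexi[d] C) C.
Proof.
move=> [unC [K [Kch Kcov]]] minC.
have [n nS] : exists n, ~ countable [set c : C |
    setT c /\ ~ countable [set y : C | K n (c, y)]].
  apply: uncountable_pigeonhole => // c _.
  have [|n] := @uncountable_pigeonhole C setT (fun y n => K n (c, y)) unC.
    move=> y _; have : [set: C *p C] (c, y) by [].
    by rewrite -Kcov => -[n _ Kn]; exists n.
  move=> h; exists n; move: h; congr (~ countable _).
  by apply/seteqP; split=> y /=; tauto.
have [g gP gS] := minC _ nS.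
(* Consecutive rows may share an endpoint, so the least point of each is
   discarded. *)
pose I c := [set y : C | K n (g c, y) /\ exists2 z, K n (g c, z) & z < y].
have nI c : ~ countable (I c).
  have [_ nc] := gS c; move=> cI; apply: nc.
  have [[m [Km mI]]|nm] := pselect (exists m, K n (g c, m) /\ ~ I c m).
    apply: (@sub_countable _ _ _ (I c `|` [set m])); last first.
      by rewrite -bigcup2E; apply: bigcup_countable => // -[|[|i]] _ //=.
    apply: subset_card_le => y /= Ky.
    have [?|ny] := pselect (I c y); [by left|right].
    case: (ltgtP y m) => // lt.
      by case: mI; split=> //; exists y.
    by case: ny; split=> //; exists m.
  apply: sub_countable cI; apply: subset_card_le => y Ky; apply: contrapT => ny.
  by apply: nm; exists y.
have /choice[f fP] : forall c, exists f : C -> C,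
    {homo f : x y / x < y} /\ forall x, I c (f x).
  by move=> c; have [f ? ?] := minC _ (nI c); exists f.
exists (fun p : C *lexi[d] C => f p.1 p.2) => x y /ltlexP[lt|[-> lt]]; last first.
  exact: (fP _).1.
have [Kx _] := (fP x.1).2 x.2; have [Ky [z Kz zy]] := (fP y.1).2 y.2.
apply: le_lt_trans zy.
have := Kch n _ _ Kx Kz; rewrite !leEprod /=.
by case=> /andP[] // + _; rewrite leNgt gP.
Qed.

(** The points (c, f c) are pairwise incomparable in the componentwise order, so
each chain of a countable cover contains at most one of them. *)
Lemma countryman_no_decreasing (f : C -> C) :
  countryman C -> ~ (forall x y, x < y -> f y < f x).
Proof.
move=> [unC [K [Kch Kcov]]] fP; apply: unC.
have /choice[n nP] : forall c, exists n, K n (c, f c).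
  move=> c; have : [set: C *p C] (c, f c) by [].
  by rewrite -Kcov => -[n _ Kn]; exists n.
apply/countable_injP; exists n => x y _ _ nxy.
have nlt (u v : C) : u < v -> n u <> n v.
  move=> uv nuv; have := Kch (n v) (u, f u) (v, f v).
  rewrite -{1}nuv => /(_ (nP _) (nP _)); rewrite !leEprod /=.
  by case=> /andP[]; [rewrite (leNgt (f u)) fP | rewrite leNgt uv].
by case: (ltgtP x y) => // /nlt; rewrite nxy.
Qed.

Lemma idem_dual : idempotent_minimal C -> idempotent_minimal (C^d : orderType _).
Proof.
move=> [unC minC [e eP]]; split=> //.
  move=> S nS; have [f fP fS] := minC S nS; exists f => // x y.
  by rewrite !ltEdual => /fP.
exists e => x y /ltlexP xy; rewrite ltEdual; apply: (eP); apply/ltlexP.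
by case: xy => [?|[-> ?]]; [left|right].
Qed.

End Countryman.

Lemma idem_two_points d (L : orderType d) :
  idempotent_minimal L -> exists a b : L, a < b.
Proof.
move=> [unL _ _]; apply: contrapT => h; apply: unL.
apply/countable_injP; exists (fun=> 0%N) => x y _ _ _.
by case: (ltgtP x y) => // xy; case: h; [exists x, y|exists y, x].
Qed.

(** A copy of L, a point, and another copy of L, in this order. *)
Lemma idem_split d (L : orderType d) : idempotent_minimal L ->
  exists (l r : L -> L) (p : L),
  [/\ {homo l : x y / x < y}, {homo r : x y / x < y},
      forall x, l x < p & forall x, p < r x].
Proof.
move=> gL; have [_ _ [e eP]] := gL; have [a [b ab]] := idem_two_points gL.
exists (fun x => e (a, e (a, x))), (fun x => e (b, x)), (e (a, e (b, a))).
split=> [x y xy|x y xy|x|x]; apply: (eP); apply/ltlexP => /=.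
- by right; split=> //; apply: (eP); apply/ltlexP; right.
- by right.
- by right; split=> //; apply: (eP); apply/ltlexP; left.
- by left.
Qed.

(** The dyadic position of x among q j, ..., q (j + n - 1): starting from j, go
left or right according to the side of q j on which x lies. If x = q (j + n),
the n steps end at the point p reserved for x. *)
Fixpoint word d (T : orderType d) (U : Type) (q : nat -> T) (l r : U -> U)
    (p : U) (x : T) n j : U :=
  if n is n'.+1 then
    if x < q j then l (word q l r p x n' j.+1) else r (word q l r p x n' j.+1)
  else p.

(** Two points follow the same path until they are separated by some q i, or
until one of them is itself q i; then they lie on different sides of p. *)
Lemma word_homo d d' (T : orderType d) (U : orderType d') (q : nat -> T)
    (l r : U -> U) (p : U) :
  {homo l : x y / x < y} -> {homo r : x y / x < y} ->
  (forall x, l x < p) -> (forall x, p < r x) ->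
  forall n m j x y, x < y -> q (j + n)%N = x -> q (j + m)%N = y ->
    word q l r p x n j < word q l r p y m j.
Proof.
move=> lP rP lp pr; elim=> [|n IH] [|m] j x y xy; rewrite ?addn0.
- by move=> -> yx; rewrite yx ltxx in xy.
- by move=> qx _ /=; rewrite qx (ltNge y) ltW /= ?pr.
- by move=> _ qy /=; rewrite qy xy lp.
rewrite !addnS -!addSn => qx qy /=; have IHxy := IH m j.+1 x y xy qx qy.
case: (ltP x) => [xq|qx'].
  by case: (ltP y) => _; [exact: lP|exact: lt_trans (lp _) (pr _)].
by rewrite (ltNge y) (le_trans qx' (ltW xy)) /=; exact: rP.
Qed.

Lemma idem_countable_embeds d (L : orderType d) d' (T : orderType d') (R : set T) :
  idempotent_minimal L -> countable R ->
  exists e : T -> L, forall x y, R x -> R y -> x < y -> e x < e y.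
Proof.
move=> gL /countable_injP[i iP].
have [l [r [p [lP rP lp pr]]]] := idem_split gL.
have [[x0 _]|R0] := pselect (exists x0, R x0); last first.
  by exists (fun=> p) => x y Rx; case: R0; exists x.
pose q n := xget x0 [set x | R x /\ i x = n].
have qi x : R x -> q (i x) = x.
  move=> Rx; rewrite /q; case: xgetP => [y _ [Ry iy]|/(_ x)/=]; last by case.
  by apply: iP; rewrite ?inE.
exists (fun x => word q l r p x (i x) 0) => x y Rx Ry xy.
by apply: word_homo => //; rewrite add0n qi.
Qed.

(** Otherwise L embeds into A. As L contains L-many disjoint intervals, S would
contain a point of each of them, and L would be countable. *)
Lemma idem_separable_countable d (L : orderType d) (S A : set L) :
  idempotent_minimal L -> countable S ->
  (forall x y, A x -> A y -> x < y -> exists2 s, S s & x < s < y) ->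
  countable A.
Proof.
move=> gL cS SA; apply: contrapT => nA; have [unL minL [e eP]] := gL.
have [a [b ab]] := idem_two_points gL; have [f fP fA] := minL _ nA.
have lt c : f (e (c, a)) < f (e (c, b)).
  by apply: fP; apply: eP; apply/ltlexP; right.
have /choice[s sP] : forall c, exists s, S s /\ f (e (c, a)) < s < f (e (c, b)).
  by move=> c; have [s ? ?] := SA _ _ (fA _) (fA _) (lt c); exists s.
apply: unL; apply: (@countable_inj_on _ _ _ S s) cS => [x _|x y _ _ sxy].
  exact: (sP x).1.
have slt u v : u < v -> s u < s v.
  move=> uv; have [_ /andP[_ su]] := sP u; have [_ /andP[sv _]] := sP v.
  apply: lt_trans su (le_lt_trans _ sv); apply: ltW; apply: fP; apply: eP.
  by apply/ltlexP; left.
exact: (homo_inj (fun u v => @slt u v)) sxy.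
Qed.

(** The map r fixes S and collapses each convex component of the complement of S
to one of its points. Distinct components are separated by points of S, so
there are only countably many of them. *)
Lemma idem_collapse_gaps d (L : orderType d) (S : set L) :
  idempotent_minimal L -> countable S ->
  exists r : L -> L,
    [/\ {homo r : x y / x <= y}, countable (range r) &
        forall s x, S s -> r x = s <-> x = s].
Proof.
move=> gL cS; have [a _] := idem_two_points gL.
pose gap c := [set y | ~ S y /\ forall s, S s -> (s < y) = (s < c)].
pose r c := if `[< S c >] then c else xget a (gap c).
have rS s : S s -> r s = s by rewrite /r; case: asboolP.
have rgap c : ~ S c -> gap c (r c).
  move=> nS; rewrite /r; case: asboolP => // _.
  by case: xgetP => [y -> //|/(_ c)[]]; split.
have gapE c c' : gap c c' -> ~ S c -> r c' = r c.
  move=> [nS' h] nS; rewrite /r; case: asboolP => // _; case: asboolP => // _.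
  congr xget; apply/seteqP.
  by split=> y [nSy hy]; split=> // s Ss; rewrite hy ?h.
have rgt c s : ~ S c -> S s -> (s < r c) = (s < c).
  by move=> nS Ss; have [_ ->] := rgap c nS.
have rne c s : ~ S c -> S s -> r c != s.
  move=> nS Ss; apply/eqP => e; have [nSr _] := rgap c nS.
  by rewrite e in nSr.
exists r; split=> [x y xy||s x Ss].
- have [Sx|nSx] := pselect (S x); have [Sy|nSy] := pselect (S y).
  + by rewrite !rS.
  + rewrite rS // ltW // rgt // lt_neqAle xy andbT.
    by apply/eqP => e; rewrite -e in nSy.
  + by rewrite (rS y) // leNgt rgt // -leNgt.
  + rewrite leNgt; apply/negP => ltr.
    suff /gapE-/(_ nSx) e : gap x y by rewrite e ltxx in ltr.
    split=> // s Ss; apply/idP/idP => [sy|sx]; last exact: lt_le_trans xy.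
    by rewrite -rgt //; apply: lt_trans ltr; rewrite rgt.
- pose A := r @` [set c | ~ S c].
  apply: (@sub_countable _ _ _ (S `|` A)).
    apply: subset_card_le => _ [c _ <-].
    by have [Sc|nSc] := pselect (S c); [left; rewrite rS|right; exists c].
  rewrite -bigcup2E; apply: bigcup_countable => // -[|[|i]] _ //=.
  apply: (idem_separable_countable gL cS) => _ _ [x nx <-] [y ny <-] lt.
  apply: contrapT => no; suff /gapE-/(_ nx) e : gap x y by rewrite e ltxx in lt.
  split=> // s Ss; rewrite -(rgt x) // -(rgt y) //; apply/idP/idP => [sy|sx].
    rewrite ltNge; apply/negP => xs; apply: no; exists s => //.
    by rewrite sy lt_neqAle xs rne.
  exact: lt_trans lt.
- split=> [|->]; last exact: rS.
  have [Sx|nSx] := pselect (S x); first by rewrite rS.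
  by move/eqP; rewrite (negbTE (rne _ _ _ _)).
Qed.

(** * Suborders and their embeddings *)

(** A suborder is kept as a subset of an ambient order, so that its intersection
with the fibres of a map needs no new type. *)
Definition fits d d' (T : orderType d) (A : set T) (U : orderType d') : Prop :=
  exists f : T -> U, forall x y, A x -> A y -> x < y -> f x < f y.

Definition hosts d d' (T : orderType d) (A : set T) (U : orderType d') : Prop :=
  exists h : U -> T, {homo h : x y / x < y} /\ forall u, A (h u).

Lemma fits_embeds d d1 d2 (T : orderType d) (A : set T) (U : orderType d1)
    (V : orderType d2) : fits A U -> embeds U V -> fits A V.
Proof.
by move=> [f fP] [g gP]; exists (g \o f) => x y Ax Ay xy; exact/gP/fP.
Qed.

Lemma fits_sub d d' (T : orderType d) (A B : set T) (U : orderType d') :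
  A `<=` B -> fits B U -> fits A U.
Proof. by move=> AB [f fP]; exists f => x y /AB Bx /AB; exact: fP. Qed.

Lemma hosts_sub d d' (T : orderType d) (A B : set T) (U : orderType d') :
  A `<=` B -> hosts A U -> hosts B U.
Proof. by move=> AB [h [hP hA]]; exists h; split=> // u; exact: AB. Qed.

Lemma fits_glue d d1 d2 d3 (T : orderType d) (A : set T) (R : orderType d1)
    (U : orderType d2) (r : T -> R) :
  (forall x y, A x -> A y -> x < y -> r x <= r y) ->
  (forall c, fits (A `&` r @^-1` [set c]) U) -> fits A (R *lexi[d3] U).
Proof.
move=> rP /choice[f fP]; exists (fun x => (r x, f (r x) x)) => x y Ax Ay xy.
apply/ltlexP => /=; have := rP _ _ Ax Ay xy.
rewrite le_eqVlt => /orP[/eqP e|]; [right|by left].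
by split=> //; rewrite e; apply: fP.
Qed.

Lemma embeds_lex d d' d1 d2 d3 d4 (A : orderType d1) (A' : orderType d2)
    (B : orderType d3) (B' : orderType d4) :
  embeds A A' -> embeds B B' -> embeds (A *lexi[d] B) (A' *lexi[d'] B').
Proof.
move=> [f fP] [g gP]; exists (fun x => (f x.1, g x.2)) => x y /ltlexP xy.
apply/ltlexP => /=.
by case: xy => [/fP|[-> /gP]]; [left|right].
Qed.

Lemma embeds_refl d (A : orderType d) : embeds A A.
Proof. by exists id. Qed.

(** Absorption of the square makes the outer index of a lexicographic product
idempotent: L-many copies of (L-many copies of U) is again L-many copies of U. *)
Lemma embeds_lex_absorb d d' d1 d2 (L : orderType d1) (U : orderType d2) :
  idempotent_minimal L -> embeds (L *lexi[d] (L *lexi[d'] U)) (L *lexi[d'] U).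
Proof.
move=> [_ _ [e eP]]; exists (fun x => (e (x.1, x.2.1), x.2.2)) => x y.
move=> /ltlexP[lt|[-> /ltlexP[lt|[-> lt]]]]; apply/ltlexP => /=.
- by left; apply: eP; apply/ltlexP; left.
- by left; apply: eP; apply/ltlexP; right.
- by right.
Qed.

(** * The two towers *)

Fact tower_display : Order.disp_t. Proof. exact: (Order.Disp tt tt). Qed.

(** [tower n C D] and [tower n D C] are the orders E_n and F_n. The one-point
order is written as a product only to give it the display of the other
levels. *)
Fixpoint tower n d1 d2 (C : orderType d1) (D : orderType d2) :
    orderType tower_display :=
  if n is n'.+1 then (C *lexi[tower_display] tower n' D C : orderType _)
  else ('I_1 *lexi[tower_display] 'I_1 : orderType _).

Lemma tower0_eq d1 d2 (C : orderType d1) (D : orderType d2)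
  (x y : tower 0 C D) : x = y.
Proof. by case: x y => [x x'] [y y']; rewrite !(ord1 x, ord1 x', ord1 y, ord1 y'). Qed.

Lemma tower_ltP n d1 d2 (C : orderType d1) (D : orderType d2)
    (x y : tower n.+1 C D) :
  x < y <-> x.1 < y.1 \/ x.1 = y.1 /\ x.2 < y.2.
Proof. exact: ltlexP. Qed.

Lemma idem_point d (L : orderType d) : idempotent_minimal L -> exists x : L, True.
Proof. by move=> /idem_two_points[a _]; exists a. Qed.

Lemma tower_pt n d1 d2 (C : orderType d1) (D : orderType d2) :
  idempotent_minimal C -> idempotent_minimal D -> exists x : tower n C D, True.
Proof.
elim: n d1 d2 C D => [|n IH] d1 d2 C D gC gD; first by exists (ord0, ord0).
by have [c _] := idem_point gC; have [x _] := IH _ _ _ _ gD gC; exists (c, x).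
Qed.

Lemma tower_up n d1 d2 (C : orderType d1) (D : orderType d2) :
  idempotent_minimal D -> embeds (tower n C D) (tower n.+1 D C).
Proof.
move=> gD; have [p _] := idem_point gD.
by exists (fun x => (p, x)) => x y xy; apply/tower_ltP; right.
Qed.

(** Countable sums: the countable set of indices itself embeds into L, and L
absorbs it. *)
Lemma fits_countable_index d d1 d2 d3 d4 (T : orderType d) (A : set T)
    (R : orderType d1) (L : orderType d2) (U : orderType d3) (r : T -> R) :
  idempotent_minimal L -> countable (r @` A) ->
  (forall x y, A x -> A y -> x < y -> r x <= r y) ->
  (forall c, fits (A `&` r @^-1` [set c]) (L *lexi[d4] U)) ->
  fits A (L *lexi[d4] U).
Proof.
move=> gL cR rP fib; have [e eP] := idem_countable_embeds gL cR.
have rA x : A x -> (r @` A) (r x) by exists x.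
have eI x y : A x -> A y -> e (r x) = e (r y) -> r x = r y.
  move=> Ax Ay exy; case: (ltgtP (r x) (r y)) => // lt.
    by have := eP _ _ (rA _ Ax) (rA _ Ay) lt; rewrite exy ltxx.
  by have := eP _ _ (rA _ Ay) (rA _ Ax) lt; rewrite exy ltxx.
apply: (fits_embeds _ (embeds_lex_absorb d4 d4 U gL)).
apply: (@fits_glue _ _ _ _ _ _ _ _ (e \o r)) => [x y Ax Ay xy|c].
  have := rP _ _ Ax Ay xy; rewrite le_eqVlt => /orP[/eqP/= ->//|lt].
  by apply: ltW; apply: eP => //; exact: rA.
have [[x [Ax xc]]|no] := pselect (exists x, A x /\ e (r x) = c).
  apply: fits_sub (fib (r x)) => y [Ay /= yc]; split=> //=.
  by apply: eI => //; rewrite yc.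
have /choice[f _] := fib; exists (fun t => f (r t) t) => y z [Ay yc].
by case: no; exists y.
Qed.

(** Fibres over C that do not contain the base F_m of E_(m+1) add up to no more
than E_m: for m = 0 they are empty, and E_m = C * F_(m-1) absorbs a further sum
over C otherwise. *)
Lemma fits_sparse_fibres m d1 d2 d (C : orderType d1) (D : orderType d2)
    (T : orderType d) (B : set T) (r : T -> C) :
  idempotent_minimal C -> idempotent_minimal D ->
  (forall x y, B x -> B y -> x < y -> r x <= r y) ->
  (forall c, ~ hosts (B `&` r @^-1` [set c]) (tower m D C)) ->
  (forall c, fits (B `&` r @^-1` [set c]) (tower m C D)) ->
  fits B (tower m C D).
Proof.
case: m => [|m] gC gD rP nB fB.
  have [t _] := tower_pt 0 gC gD; exists (fun=> t) => x y Bx _ _.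
  case: (nB (r x)); exists (fun=> x); split=> // u v.
  by rewrite (tower0_eq u v) ltxx.
apply: (fits_embeds _ (embeds_lex_absorb tower_display _ _ gC)).
exact: (@fits_glue _ _ _ _ _ _ _ _ r).
Qed.

(** The outer induction is on m, the inner one on n, for both towers at once. Let
A be a suborder of E_(n+1), a sum over C of fibres in F_n. By the inner
induction all fibres embed into F_(m+1). If uncountably many of them contained
F_m, then minimality of C would yield a copy of E_(m+1) in A. So the set S of
exceptional indices is countable, and the part of A over each gap of S embeds
into E_m, hence into F_(m+1). There are only countably many gaps, and countable
sums do not leave F_(m+1). If A is a suborder of F_(n+1), the fibres embed into
F_(m+1), which absorbs the sum over D. *)
Lemma tower_dichotomy m : forall n d1 d2 (C : orderType d1) (D : orderType d2) d
    (T : orderType d) (A : set T),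
  idempotent_minimal C -> idempotent_minimal D ->
  fits A (tower n C D) \/ fits A (tower n D C) ->
  ~ hosts A (tower m C D) -> fits A (tower m D C).
Proof.
elim: m => [|m IHm] n d1 d2 C D d T A gC gD.
  move=> _ nA; have A0 x : A x -> False.
    move=> Ax; apply: nA; exists (fun=> x); split=> // u v.
    by rewrite (tower0_eq u v) ltxx.
  by have [p _] := tower_pt 0 gD gC; exists (fun=> p) => x y /A0.
elim: n T A => [|n IHn] T A.
  move=> fA _; have [p _] := tower_pt m.+1 gD gC; exists (fun=> p) => x y Ax Ay.
  by case: fA => -[f fP] /(fP _ _ Ax Ay); rewrite (tower0_eq (f x) (f y)) ltxx.
move=> fA nA.
have fib d' (X : orderType d') (r : T -> X) c :
    fits (A `&` r @^-1` [set c]) (tower n C D) \/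
    fits (A `&` r @^-1` [set c]) (tower n D C) ->
    fits (A `&` r @^-1` [set c]) (tower m.+1 D C).
  move=> fB; apply: IHn fB _ => hB; apply: nA.
  by apply: hosts_sub hB => x [].
case: fA => -[f fP].
  pose r x := (f x).1.
  have rP x y : A x -> A y -> x < y -> r x <= r y.
    by move=> Ax Ay /(fP _ _ Ax Ay)/tower_ltP[/ltW|[e _]] //; rewrite /r e.
  have fibf c : fits (A `&` r @^-1` [set c]) (tower n D C).
    exists (fun x => (f x).2) => x y [Ax /= xc] [Ay /= yc] /(fP _ _ Ax Ay).
    by move=> /tower_ltP[]; [rewrite -/(r x) -/(r y) xc yc ltxx|case].
  pose S := [set c | hosts (A `&` r @^-1` [set c]) (tower m D C)].
  have cS : countable S.
    apply: contrapT => nS; apply: nA; have [_ minC _] := gC.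
    have [g gP /= gS] := minC S nS; have [h hP] := choice gS.
    exists (fun x : tower m.+1 C D => h x.1 x.2); split; last first.
      by move=> u; have [_ /(_ u.2)[]] := hP u.1.
    move=> x y /tower_ltP xy /=; case: xy => [lt|[-> lt]]; last first.
      by have [+ _] := hP y.1; apply.
    have [_ /(_ x.2)[Ax xc]] := hP x.1; have [_ /(_ y.2)[Ay yc]] := hP y.1.
    case: (ltgtP (h x.1 x.2) (h y.1 y.2)) => //.
      move=> /(rP _ _ Ay Ax); have := gP _ _ lt.
      by rewrite /= in xc yc; rewrite xc yc leNgt => ->.
    by move=> e; have := gP _ _ lt; rewrite -xc -yc /= e ltxx.
  have [q [qP cq qS]] := idem_collapse_gaps gC cS.
  apply: (@fits_countable_index _ _ _ _ _ _ _ _ _ _ (q \o r)) => //.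
  - by apply: sub_countable cq; apply: subset_card_le => _ [x _ <-]; exists (r x).
  - by move=> x y Ax Ay xy; apply: qP; exact: rP.
  move=> c; have [Sc|nSc] := pselect (S c).
    have := fib _ _ r c (or_intror (fibf c)).
    by apply: fits_sub => x [Ax /= xc]; split=> //; apply/(qS _ _ Sc).
  pose B := A `&` (q \o r) @^-1` [set c].
  have nB c' : ~ hosts (B `&` r @^-1` [set c']) (tower m D C).
    move=> hB; have [t _] := tower_pt m gD gC.
    have [h [_ /(_ t)[[_ /= xc] /= xc']]] := hB.
    have Sc' : S c' by apply: hosts_sub hB => y [[Ay _] yc]; split.
    by apply: nSc; rewrite -xc xc' (qS _ _ Sc').2.
  apply: (fits_embeds _ (tower_up m C gD)).
  apply: (@fits_sparse_fibres _ _ _ _ _ _ _ _ r) => // [x y [Ax _] [Ay _]|c'].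
    exact: rP.
  apply: IHm (nB c') => //; left.
  by apply: fits_sub (fibf c') => x [[]].
apply: (fits_embeds _ (embeds_lex_absorb tower_display _ _ gD)).
have rP x y : A x -> A y -> x < y -> (f x).1 <= (f y).1.
  by move=> Ax Ay /(fP _ _ Ax Ay)/tower_ltP[/ltW|[-> _]].
apply: (@fits_glue _ _ _ _ _ _ _ _ (fun x => (f x).1)) => [//|c].
apply: fib => //; left.
exists (fun x => (f x).2) => x y [Ax /= xc] [Ay /= yc] /(fP _ _ Ax Ay).
by move=> /tower_ltP[]; [rewrite xc yc ltxx|case].
Qed.

Lemma tower_succ n d1 d2 (C : orderType d1) (D : orderType d2) :
  idempotent_minimal C -> idempotent_minimal D ->
  embeds (tower n C D) (tower n.+1 C D).
Proof.
elim: n d1 d2 C D => [|n IH] d1 d2 C D gC gD; last first.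
  exact: embeds_lex (embeds_refl C) (IH _ _ _ _ gD gC).
have [p _] := tower_pt 1 gC gD; exists (fun=> p) => x y.
by rewrite (tower0_eq x y) ltxx.
Qed.

Lemma tower_mono m n d1 d2 (C : orderType d1) (D : orderType d2) :
  idempotent_minimal C -> idempotent_minimal D -> (m <= n)%N -> embeds (tower m C D) (tower n C D).
Proof.
move=> gC gD /subnK <-; elim: (n - m)%N => [|k IH]; first exact: embeds_refl.
by rewrite addSn; apply: embeds_trans IH (tower_succ _ _ _).
Qed.

(** Under an embedding of E_(n+1) into F_(n+1), no copy of F_n can be mapped into
a single copy of E_n, by induction. Hence each copy of F_n meets two different
copies of E_n, and the choice of the first one gives an embedding of the index
C of the copies into D. For n = 0 the copies are points, and the map on indices
is itself strictly increasing. *)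
Lemma tower_incomparable n d1 d2 (C : orderType d1) (D : orderType d2) :
  idempotent_minimal C -> idempotent_minimal D -> ~ embeds C D -> ~ embeds D C ->
  ~ embeds (tower n.+1 C D) (tower n.+1 D C).
Proof.
elim: n d1 d2 C D => [|n IH] d1 d2 C D gC gD CD DC [f fP].
  have [t _] := tower_pt 0 gD gC; apply: CD; exists (fun c => (f (c, t)).1) => x y xy.
  have /fP/tower_ltP[//|[_]] : ((x, t) : tower 1 C D) < (y, t).
    by apply/tower_ltP; left.
  by rewrite (@tower0_eq _ _ C D (f (x, t)).2 (f (y, t)).2) ltxx.
have fibP c : exists t : tower n.+1 D C * tower n.+1 D C,
    (f (c, t.1)).1 < (f (c, t.2)).1.
  apply: contrapT => no; apply: (IH _ _ D C gD gC DC CD).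
  exists (fun t => (f (c, t)).2) => s t st.
  have /fP/tower_ltP[lt|[_ //]] : ((c, s) : tower n.+2 C D) < (c, t).
    by apply/tower_ltP; right.
  by case: no; exists (s, t).
have [t tP] := choice fibP.
apply: CD; exists (fun c => (f (c, (t c).1)).1) => x y xy.
apply: lt_le_trans (tP x) _.
have /fP/tower_ltP[/ltW//|[-> //]] :
  ((x, (t x).2) : tower n.+2 C D) < (y, (t y).1).
by apply/tower_ltP; left.
Qed.

Lemma tower_strict n d1 d2 (C : orderType d1) (D : orderType d2) :
  idempotent_minimal C -> idempotent_minimal D -> ~ embeds C D -> ~ embeds D C ->
  ~ embeds (tower n.+2 C D) (tower n.+1 C D).
Proof.
move=> gC gD CD DC h; apply: (tower_incomparable gD gC DC CD (n := n)).
exact: embeds_trans (tower_up _ _ gC) h.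
Qed.

(** * The sum of the tower *)

Section TowerSum.
Variables (d1 d2 : Order.disp_t) (C : orderType d1) (D : orderType d2).
Hypotheses (gC : idempotent_minimal C) (gD : idempotent_minimal D).
Hypotheses (CD : ~ embeds C D) (DC : ~ embeds D C).

Let E n : orderType tower_display := tower n C D.
Let H := {n : nat & E n}.
Let level n (t : E n) : H := Tagged E t.

Lemma lt_tag (x y : H) : (tag x < tag y)%N -> x < y.
Proof.
by move=> h; rewrite Order.SigmaOrder.ltEsig !leEnat ltnW //= leqNgt h.
Qed.

Lemma le_tag (x y : H) : x <= y -> (tag x <= tag y)%N.
Proof. by rewrite Order.SigmaOrder.leEsig => /andP[]. Qed.

Lemma lt_level n (t u : E n) : (level t < level u) = (t < u).
Proof. by rewrite Order.SigmaOrder.ltEsig /= lexx tagged_asE. Qed.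

Lemma fits_tag d (T : orderType d) (A : set T) (f : T -> H) n :
  (forall x y, A x -> A y -> x < y -> f x < f y) ->
  fits (A `&` (fun x => tag (f x)) @^-1` [set n]) (E n).
Proof.
move=> fP; have [p _] := tower_pt n gC gD.
exists (fun x => tagged_as (level p) (f x)) => x y [Ax /= xn] [Ay /= yn] /(fP _ _ Ax Ay).
case: (f x) xn => i u /= iu; subst i; case: (f y) yn => j v /= jv; subst j.
by rewrite !tagged_asE -/(level u) -/(level v) lt_level.
Qed.

Lemma fits_sum d (T : orderType d) (A : set T) (f : T -> H) M :
  (forall x y, A x -> A y -> x < y -> f x < f y) ->
  (forall n, fits (A `&` (fun x => tag (f x)) @^-1` [set n]) (E M.+1)) ->
  fits A (E M.+1).
Proof.
move=> fP fib.
apply: (@fits_countable_index _ _ _ _ _ _ _ _ _ _ (fun x => tag (f x))) => //.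
  exact: (@countableP nat).
by move=> x y Ax Ay /(fP _ _ Ax Ay)/ltW/le_tag.
Qed.

(** As countable sums stay within E_(k+1), an initial segment of H is no larger
than a single level. *)
Lemma bounded_fits d (T : orderType d) (f : T -> H) k :
  {homo f : x y / x < y} -> (forall x, (tag (f x) <= k)%N) ->
  embeds T (E k.+1).
Proof.
move=> fP fk; have fP' x y : setT x -> setT y -> x < y -> f x < f y by auto.
have [g gP] : fits [set: T] (E k.+1).
  apply: (fits_sum fP') => n; have [nk|kn] := leqP n k.
    by apply: fits_embeds (fits_tag _ fP') _; apply: tower_mono => //; exact: leqW.
  have [p _] := tower_pt k.+1 gC gD; exists (fun=> p) => x y [_ /= xn].
  by have := fk x; rewrite xn leqNgt kn.
by exists g => x y; exact: gP.
Qed.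

Lemma sum_right_indecomposable : strictly_indecomposable_right (H : orderType _).
Proof.
move=> e1 e2 A B [f [g fK gK] fP] [b0].
have gP x y : x < y -> g x < g y by move=> xy; rewrite -fP !gK.
have fP' : {homo f : x y / x < y} by move=> x y; rewrite fP.
pose h0 := g (inr b0); pose k := tag h0.
split; first split.
- by exists (g \o inl) => x y xy; apply: gP.
- move=> [phi phiP]; apply: (tower_strict gC gD CD DC (n := k)).
  apply: (@bounded_fits _ (E k.+2) (fun t => g (inl (phi (level t))))) => [x y xy|x].
    by apply: gP; apply: phiP; rewrite lt_level.
  by apply: le_tag; apply: ltW; exact: gP.
- pose j n : E n -> E (n + k.+1)%N :=
    sval (cid (tower_mono gC gD (leq_addr k.+1 n))).
  have jP n : {homo @j n : x y / x < y} := svalP (cid (tower_mono gC gD (leq_addr k.+1 n))).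
  pose s (x : H) : H := level (@j (tag x) (tagged x)).
  have sP : {homo s : x y / x < y}.
    move=> [n t] [m u] tu; have := le_tag (ltW tu); rewrite /= leq_eqVlt.
    case/orP => [/eqP e|nm]; last by apply: lt_tag; rewrite /= ltn_add2r.
    subst m; rewrite /s lt_level; apply: jP.
    by move: tu; rewrite -/(level t) -/(level u) lt_level.
  exists (fun x => if f (s x) is inr b then b else b0) => x y xy.
  have f0 z : exists b, f (s z) = inr b.
    have : f h0 < f (s z) by apply: fP'; apply: lt_tag; rewrite /= addnS ltnS leq_addl.
    by rewrite /h0 gK; case: (f _) => // b _; exists b.
  have := fP' _ _ (sP _ _ xy).
  by have [b ->] := f0 x; have [b' ->] := f0 y.
Qed.

Lemma sum_succ_embeds d (P : orderType d) :
  strictly_embeds P (H : orderType _) -> embeds (osum P 'I_1) (H : orderType _).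
Proof.
move=> [[f fP] nHP].
have fP' x y : setT x -> setT y -> x < y -> f x < f y by auto.
pose A n := [set: P] `&` (fun x => tag (f x)) @^-1` [set n].
suff [M [g gP]] : exists M, fits [set: P] (E M).
  have [p _] := tower_pt M.+1 gC gD.
  exists (fun x => if x is inl a then level (g a) else level p) => -[a|i] [b|j] //=.
  - by move=> ab; rewrite lt_level; apply: gP.
  - by move=> _; apply: lt_tag => /=.
  - by rewrite [_ < _]/(i < j) (ord1 i) (ord1 j) ltxx.
have [[m [N mN]]|no] :=
    pselect (exists m N, forall n, (N <= n)%N -> ~ hosts (A n) (E m)).
  pose M := (m + N)%N; exists M.+1; apply: (fits_sum fP') => n.
  have [Nn|nN] := leqP N n.
    have : fits (A n) (tower m D C).
      apply: (@tower_dichotomy m n _ _ C D) => //; last exact: mN.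
      by left; exact: fits_tag.
    move/fits_embeds; apply; apply: (@embeds_trans _ _ _ _ (E m.+1)).
      exact: tower_up.
    by apply: tower_mono => //; rewrite ltnS leq_addr.
  apply: fits_embeds (fits_tag _ fP') _; apply: tower_mono => //.
  by apply: leqW; apply: leq_trans (ltnW nN) _; exact: leq_addl.
case: nHP.
have /choice[nu nuP] : forall mN : nat * nat, exists n,
    (mN.2 <= n)%N /\ hosts (A n) (E mN.1).
  move=> [m N]; apply: contrapT => no'; apply: no; exists m, N => n Nn hA.
  by apply: no'; exists n.
(* Strictly increasing levels i k, with a copy of E_k on the level i k: together
   these copies form a copy of H in P. *)
pose i := fix i k := if k is k'.+1 then nu (k, (i k').+1) else nu (0, 0)%N.
have iS k : (i k < i k.+1)%N by exact: (nuP (k.+1, (i k).+1)).1.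
have iP k : hosts (A (i k)) (E k) by case: k => [|k]; exact: (nuP _).2.
pose h k : E k -> P := sval (cid (iP k)).
have hP k : {homo @h k : x y / x < y} /\ (forall u, A (i k) (@h k u)) :=
  svalP (cid (iP k)).
have ilt : {homo i : k l / (k < l)%N} by apply: homo_ltn => //; exact: ltn_trans.
exists (fun x : H => @h (tag x) (tagged x)) => -[n t] [m u] tu /=.
have := le_tag (ltW tu); rewrite /= leq_eqVlt => /orP[/eqP e|nm].
  by subst m; apply: (hP n).1; move: tu; rewrite -/(level t) -/(level u) lt_level.
apply: (homo_ltV fP); apply: lt_tag.
by have [_ /(_ t)[_ /= ->]] := hP n; have [_ /(_ u)[_ /= ->]] := hP m; exact: ilt.
Qed.

(** H contains C, which has a self-embedding l moving some point down. Applying l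
to the least such point gives a smaller one, which l moves down as well. *)
Lemma sum_not_ordinal : ~ is_ordinal (H : orderType _).
Proof.
have [l [_ [p [lP _ lp _]]]] := idem_split gC; have [t _] := tower_pt 0 gD gC.
pose c (x : C) : H := level ((x, t) : E 1).
have cP : {homo c : x y / x < y}.
  by move=> x y xy; rewrite lt_level; apply/tower_ltP; left.
move=> /(_ [pred x : H | `[< exists y, x = c y /\ l y < y >]])[].
  by exists (c p); apply/asboolP; exists p.
move=> x [[/asboolP[y [-> ly]] ymin] _].
have /ymin : c (l y) \in [pred x : H | `[< exists y, x = c y /\ l y < y >]].
  by apply/asboolP; exists (l y); split=> //; exact: lP.
by rewrite leNgt cP.
Qed.

Lemma sum_hagendorf : hagendorf (H : orderType _).
Proof.
split; [exact: sum_right_indecomposable|exact: sum_succ_embeds|exact: sum_not_ordinal].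
Qed.
End TowerSum.

(** * Cardinality *)

Lemma card_le_inj (T U : Type) (f : T -> U) :
  injective f -> ([set: T] #<= [set: U])%card.
Proof.
move=> finj; apply: (@card_le_trans _ _ _ (range f)); last exact: subset_card_le.
suff : ([set: T] #= range f)%card by rewrite card_eq_le => /andP[].
by rewrite card_eq_sym; apply: inj_card_eq => x y _ _; exact: finj.
Qed.

Section WellOrder.
Variables (T : choiceType) (R : rel T).
Hypothesis woR : wochoice.well_order R.

Lemma wo_min (A : set T) : A !=set0 -> exists2 z, A z & forall x, A x -> R z x.
Proof.
move=> [x Ax]; have [|z [[/asboolP Az zmin] _]] := woR (A := [pred x | `[< A x >]]).
  by exists x; apply/asboolP.
by exists z => // y Ay; apply: zmin; apply/asboolP.
Qed.

Lemma wo_total : total R.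
Proof.
move=> x y; have [|z [] -> h] := @wo_min [set x; y]; first by exists x; left.
- by rewrite h //; right.
- by rewrite orbC h //; left.
Qed.

Lemma wo_anti : antisymmetric R.
Proof.
move=> x y; have RR z : R z z by have := wo_total z z; rewrite orbb.
case/andP=> xy yx; have [|z [_ zu]] := woR (A := [pred z | (z == x) || (z == y)]).
  by exists x; rewrite inE eqxx.
have <- : z = x by apply: zu; split=> [|t /orP[]/eqP->//]; rewrite inE eqxx.
by apply: zu; split=> [|t /orP[]/eqP->//]; rewrite inE eqxx orbT.
Qed.

Lemma wo_trans : transitive R.
Proof.
move=> y x z xy yz; have [|t [[]|] -> h] := @wo_min [set x; y; z].
- by exists x; left; left.
- by apply: h; right.
- have yx : R y x by apply: h; left; left.
  by have -> : x = y by apply: wo_anti; rewrite xy.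
- have zy : R z y by apply: h; left; right.
  by have <- : y = z by apply: wo_anti; rewrite yz.
Qed.
End WellOrder.

(** The proof [woR] is a parameter of the type so that the order instance can be
built from it. *)
Definition wo_sub (T : choiceType) (R : rel T) (woR : wochoice.well_order R)
  (S : pred T) : Type := {x : T | S x}.

Section WoSub.
Variables (T : choiceType) (R : rel T) (woR : wochoice.well_order R).
Variable S : pred T.
Implicit Types x y : wo_sub woR S.

Definition wo_sub_le x y := R (sval x) (sval y).
Definition wo_sub_lt x y := (sval y != sval x) && R (sval x) (sval y).

HB.instance Definition _ := Choice.copy (wo_sub woR S) {x : T | S x}.

Fact wo_sub_lt_def x y : wo_sub_lt x y = (y != x) && wo_sub_le x y.
Proof. by []. Qed.

Fact wo_sub_anti : antisymmetric wo_sub_le.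
Proof. by move=> x y h; apply: val_inj; exact: (wo_anti woR h). Qed.

Fact wo_sub_trans : transitive wo_sub_le.
Proof. by move=> y x z; exact: (wo_trans woR). Qed.

Fact wo_sub_total : total wo_sub_le.
Proof. by move=> x y; exact: (wo_total woR). Qed.

HB.instance Definition _ :=
  Order.isOrder.Build tower_display (wo_sub woR S)
    wo_sub_lt_def (fun _ _ => erefl) (fun _ _ => erefl)
    wo_sub_anti wo_sub_trans wo_sub_total.

Lemma wo_sub_ordinal : is_ordinal (wo_sub woR S : orderType _).
Proof.
apply: wochoice.antisymmetric_well_order => [x y|A [a Aa]]; first exact: le_anti.
have [|t [w [Aw <-]] tmin] := wo_min woR (A := [set sval w | w in [set w | w \in A]]).
  by exists (sval a), a.
by exists w; split=> // v Av; apply: tmin; exists v.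
Qed.
End WoSub.

(** Well-order T and cut at the least point with uncountably many predecessors,
if there is one. *)
Lemma omega1_in_uncountable (T : choiceType) : uncountable T ->
  exists (d : Order.disp_t) (W : orderType d) (i : W -> T),
    is_omega1 W /\ injective i.
Proof.
move=> unT; have [R woR] := wochoice.well_ordering_principle T.
pose below x := [set y | R y x /\ y != x].
have [S [nS cS]] : exists S : pred T, ~ countable [set x | S x] /\
    forall x, S x -> countable ([set x | S x] `&` below x).
  have [[x0 nx0]|no] := pselect (exists x, ~ countable (below x)); last first.
    exists predT; split=> [|x _].
      by move: unT; congr (~ countable _); apply/seteqP.
    apply: (@sub_countable _ _ _ (below x)).
      by apply: subset_card_le => y [].
    by apply: contrapT => nx; apply: no; exists x.
  have [|z nz zmin] := wo_min woR (A := [set x | ~ countable (below x)]).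
    by exists x0.
  exists (fun y => R y z && (y != z)); split.
    move: nz; congr (~ countable _).
    by apply/seteqP; split=> y /= => [[-> ->]|/andP].
  move=> x /andP[xz nxz]; apply: (@sub_countable _ _ _ (below x)).
    by apply: subset_card_le => y [].
  apply: contrapT => /zmin zx; move/eqP: nxz; apply.
  by apply: (wo_anti woR); rewrite xz.
exists _, (wo_sub woR S : orderType _), (fun x => sval x); split; last exact: val_inj.
split; first exact: wo_sub_ordinal.
  move=> cW; apply: nS; have /countable_injP[f fP] := cW.
  pose g x := if pselect (S x) is left Sx then f (exist _ x Sx) else 0%N.
  apply/countable_injP; exists g => x y; rewrite !inE /= /g => Sx Sy.
  case: pselect => // Sx'; case: pselect => // Sy' e.
  have : exist _ x Sx' = exist _ y Sy' :> wo_sub woR S by apply: fP; rewrite ?inE.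
  by move=> /(congr1 sval).
move=> x; apply: (countable_inj_on (f := sval)) (cS (sval x) (svalP x)) => [y|y z _ _].
  by case/andP=> yx Ryx; split; [exact: svalP|split=> //; rewrite eq_sym].
exact: val_inj.
Qed.

(** Absorption of the square supplies the pairing C * C -> C. *)
Lemma tower_inj n d1 d2 (C : orderType d1) (D : orderType d2) (i : C -> D)
    (j : D -> C) :
  idempotent_minimal C -> idempotent_minimal D -> injective i -> injective j ->
  exists f : tower n C D -> C, injective f.
Proof.
elim: n d1 d2 C D i j => [|n IH] d1 d2 C D i j gC gD iI jI.
  have [p _] := idem_point gC; exists (fun=> p) => x y _; exact: tower0_eq.
have [f fI] := IH _ _ D C j i gD gC jI iI; have [_ _ [e eP]] := gC.
exists (fun x => e (x.1, j (f x.2))) => -[x t] [y u] /(homo_inj eP)[/= ->].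
by move=> /jI/fI ->.
Qed.

Theorem theorem3p7 :
  (exists (d : Order.disp_t) (C : orderType d),
     countryman C /\ minimal_uncountable C) ->
  exists (d : Order.disp_t) (H : orderType d),
    hagendorf H /\ has_card_aleph1 H.
Proof.
move=> [d [C [cC minC]]].
have gC : idempotent_minimal C.
  by split=> //; [case: cC | exact: countryman_lex_square].
pose D : orderType _ := C^d.
have gD : idempotent_minimal D by exact: idem_dual.
have CD : ~ embeds C D.
  move=> [f fP]; apply: (@countryman_no_decreasing d C f cC) => x y xy.
  exact: (fP x y).
have DC : ~ embeds D C.
  move=> [f fP]; apply: (@countryman_no_decreasing d C f cC) => x y xy.
  exact: (fP y x).
pose H : orderType _ := {n : nat & tower n C D}.
exists _, H; split; first exact: sum_hagendorf.
have [unC _ [e eP]] := gC.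
have [d' [W [i [oW iI]]]] := omega1_in_uncountable unC.
exists d', W; split=> //; rewrite card_eq_le; apply/andP; split.
(* By minimality C embeds into the copy of omega_1 that it contains. *)
- have [_ unW _] := oW.
  have nS : ~ countable (range i).
    move=> cS; apply: unW; apply: (countable_inj_on (f := i)) cS => [x _|x y _ _ /iI//].
    by exists x.
  have [f fP fS] := minC _ nS.
  have /choice[w wP] : forall x, exists y, i y = f x.
    by move=> x; have [y _ <-] := fS x; exists y.
  have wI : injective w.
    by move=> x y e'; apply: (homo_inj fP); rewrite -!wP e'.
  have [q qP] := idem_countable_embeds gC (countableP [set: nat]).
  have qI : injective q by apply: homo_inj => x y; exact: qP.
  have T n : exists g : tower n C D -> C, injective g.
    exact: (@tower_inj n _ _ C D id id).
  pose g n : tower n C D -> C := sval (cid (T n)).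
  have gI n : injective (@g n) := svalP (cid (T n)).
  apply: (@card_le_inj H W (fun x => w (e (q (tag x), @g (tag x) (tagged x))))).
  move=> [n t] [m u] /wI/(homo_inj eP)[/qI /= nm].
  by subst m => /gI->.
- apply: (@card_le_inj W H
    (fun x => Tagged (fun n => tower n C D : Type) ((i x, (ord0, ord0)) : tower 1 C D))).
  move=> x y /eqP; rewrite -tag_eqE /tag_eq /= tagged_asE => /eqP[xy].
  exact: iI.
Qed.
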